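(* Let $A,B:\mathbb{R}^n\rightrightarrows\mathbb{R}^n$, let $\gamma>0$, and suppose the following. (B1) $A$ and $B$ are outer semicontinuous. (B2) $\operatorname{dom}J_{\gamma A}=\operatorname{dom}J_{\gamma B}=\mathbb{R}^n$. (B3) There exist a nonempty set $\mathcal{S}^\star\subseteq\operatorname{zer}T_{\mathrm{PD}}$ and $\beta_{\rm P},\beta_{\rm D}\in\mathbb{R}$ with $[\beta_{\rm D}]_-[\beta_{\rm P}]_-<\tfrac14$ such that the primal-dual operator $T_{\mathrm{PD}}$ has $V$-oblique weak Minty solutions at $\mathcal{S}^\star$, where $V:=\operatorname{blkdiag}(\beta_{\rm P}\mathrm{I}_n,\beta_{\rm D}\mathrm{I}_n)$. Suppose that $\gamma$ lies in the interval $$\left(\frac{2[-\beta_{\rm P}]_+}{1+\sqrt{1-4\beta_{\rm D}\beta_{\rm P}}},\ \frac{1+\sqrt{1-4\beta_{\rm D}\beta_{\rm P}}}{2[-\beta_{\rm D}]_+}\right)$$ (which is nonempty since $[\beta_{\rm D}]_-[\beta_{\rm P}]_-<\tfrac14$). Consider a sequence $(u^k,v^k,s^k)_{k\in\mathbb{N}}$ generated by Douglas–Rachford splitting (DRS) starting from $s^0\in\mathbb{R}^n$ with stepsize $\gamma$ and relaxation parameters $\lambda_k\in(0,2\alpha)$ such that $\liminf_{k\to\infty}\lambda_k(2\alpha-\lambda_k)>0$, where $\alpha:=1+\tfrac1\gamma\beta_{\rm P}+\gamma\beta_{\rm D}>0$. Then either a point for which $u^k=v^k$ is reached in a finite number of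 iterations, implying that $\big(u^k,\tfrac1\gamma(u^k-s^k)\big)\in\operatorname{zer}T_{\mathrm{PD}}$, or the following hold. (i) $\gamma^{-1}(u^k-v^k)\in Au^k+Bv^k$ for all $k$, and $(u^k-v^k)_{k\in\mathbb{N}}$ converges to zero. (ii) Every limit point (if any) of $\big(u^k,\tfrac1\gamma(u^k-s^k)\big)_{k\in\mathbb{N}}$ belongs to $\operatorname{zer}T_{\mathrm{PD}}$. (iii) The sequence $(s^k)_{k\in\mathbb{N}}$ is bounded and its limit points belong to $\{x^\star-\gamma y^\star\mid(x^\star,y^\star)\in\operatorname{zer}T_{\mathrm{PD}}\}$. (iv) If $\lambda_k(2\alpha-\lambda_k)\ge\kappa>0$ uniformly for all $k$, then for all $s^\star\in\{x^\star-\gamma y^\star\mid(x^\star,y^\star)\in\mathcal{S}^\star\}$ and all $N\in\mathbb{N}$, $$\min_{k=0,1,\dots,N}\|u^k-v^k\|^2\le\frac{\|s^0-s^\star\|^2}{(N+1)\kappa}.$$ (v) If in (B3) $\Pi\mathcal{S}^\star=\Pi\operatorname{zer}T_{\mathrm{PD}}$, then $(s^k)_{k\in\mathbb{N}}$ converges to some element of $\{x^\star-\gamma y^\star\mid(x^\star,y^\star)\in\operatorname{zer}T_{\mathrm{PD}}\}$. If additionally $J_{\gamma A}$ and $J_{\gamma B}$ are (single-valued) continuous, then $\big(u^k,\tfrac1\gamma(u^k-s^k)\big)_{k\in\mathbb{N}}$ converges to some element of $\operatorname{zer}T_{\mathrm{PD}}$.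
   Context: For a set-valued operator $T$: $\operatorname{gph}T=\{(x,y):y\in Tx\}$, $\operatorname{zer}T=\{x:0\in Tx\}$, $\operatorname{dom}T=\{x:Tx\ne\emptyset\}$; $T$ is outer semicontinuous if its graph is closed. Resolvent: $J_A=(\mathrm{id}+A)^{-1}$. $[t]_+=\max\{0,t\}$, $[t]_-=\min\{0,t\}$; the right endpoint of the stepsize interval is read as $+\infty$ when $[-\beta_{\rm D}]_+=0$ and the left endpoint as $0$ when $[-\beta_{\rm P}]_+=0$. (DRS): $u^k\in J_{\gamma A}(s^k)$, $v^k\in J_{\gamma B}(2u^k-s^k)$, $s^{k+1}=s^k+\lambda_k(v^k-u^k)$. Primal-dual operator on $\mathbb{R}^{2n}$: $T_{\mathrm{PD}}(x,y)=\big(Ax+y\big)\times\big(B^{-1}y-x\big)$. Thus $(x^\star,y^\star)\in\operatorname{zer}T_{\mathrm{PD}}$ iff $(x^\star,-y^\star)\in\operatorname{gph}A$ and $(x^\star,y^\star)\in\operatorname{gph}B$. $T$ has $V$-oblique weak Minty solutions at a nonempty set $\mathcal{S}^\star\subseteq\operatorname{zer}T$ ($V$ symmetric) if $\langle v,z-z^\star\rangle\ge\langle v,Vv\rangle$ for all $z^\star\in\mathcal{S}^\star$ and $(z,v)\in\operatorname{gph}T$. $\Pi$ is the orthogonal projection in $\mathbb{R}^{2n}$ onto the range of $P=\begin{bmatrix}\gamma^{-1}\mathrm{I}_n&-\mathrm{I}_n\\-\mathrm{I}_n&\gamma\mathrm{I}_n\end{bmatrix}$. *)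

(* Defs.v *)
From HB Require Import structures.
From mathcomp Require Import all_boot all_order all_algebra.
From mathcomp Require Import all_classical all_reals all_analysis.
Set Implicit Arguments.
Unset Strict Implicit.
Unset Printing Implicit Defensive.
Import Order.TTheory GRing.Theory Num.Theory.
Import numFieldNormedType.Exports.
Local Open Scope classical_set_scope.
Local Open Scope ring_scope.

(* R^n is 'cV[R]_n and R^(2n) is 'cV[R]_(n + n), the pair (x, y) being
   col_mx x y.  The library norm on matrices is the sup norm (it induces the
   same topology), so the Euclidean structure is defined here. *)

Definition dot (R : realType) (m : nat) (x y : 'cV[R]_m) : R :=
  \sum_(i < m) x i ord0 * y i ord0.

Definition enorm (R : realType) (m : nat) (x : 'cV[R]_m) : R :=
  Num.sqrt (dot x x).

Definition pospart (R : realType) (t : R) : R := Num.max 0 t.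
Definition negpart (R : realType) (t : R) : R := Num.min 0 t.

Definition operator (R : realType) (m : nat) := 'cV[R]_m -> set 'cV[R]_m.

Definition gph (R : realType) (m : nat) (T : operator R m) :
    set ('cV[R]_m * 'cV[R]_m) :=
  [set p | T p.1 p.2].

Definition zer (R : realType) (m : nat) (T : operator R m) : set 'cV[R]_m :=
  [set x | T x 0].

Definition dom (R : realType) (m : nat) (T : operator R m) : set 'cV[R]_m :=
  [set x | T x !=set0].

Definition outer_semicontinuous (R : realType) (m : nat) (T : operator R m) :=
  closed (gph T).

Definition op_inv (R : realType) (m : nat) (T : operator R m) : operator R m :=
  fun y => [set x | T x y].

Definition op_scale (R : realType) (m : nat) (c : R) (T : operator R m) :
    operator R m :=
  fun x => [set c *: a | a in T x].

Definition minkowski_sum (R : realType) (m : nat) (C D : set 'cV[R]_m) :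
    set 'cV[R]_m :=
  [set c + d | c in C & d in D].

Definition resolvent (R : realType) (m : nat) (T : operator R m) :
    operator R m :=
  op_inv (fun x => minkowski_sum [set x] (T x)).

Definition single_valued_continuous (R : realType) (m : nat)
    (T : operator R m) : Prop :=
  exists2 f : 'cV[R]_m -> 'cV[R]_m, continuous f & forall x, T x = [set f x].

Definition primal_dual (R : realType) (n : nat) (A B : operator R n) :
    operator R (n + n) :=
  fun z => let x := usubmx z in let y := dsubmx z in
    [set col_mx p q | p in minkowski_sum (A x) [set y]
                    & q in minkowski_sum (op_inv B y) [set - x]].

Definition oblique_weak_minty (R : realType) (m : nat) (V : 'M[R]_m)
    (T : operator R m) (S : set 'cV[R]_m) : Prop :=
  [/\ V^T = V, S !=set0, S `<=` zer T
    & forall zs z v, S zs -> gph T (z, v) ->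
        dot v (z - zs) >= dot v (V *m v)].

Definition Vmat (R : realType) (n : nat) (bP bD : R) : 'M[R]_(n + n) :=
  block_mx bP%:M 0 0 bD%:M.

Definition Pmat (R : realType) (n : nat) (gamma : R) : 'M[R]_(n + n) :=
  block_mx (gamma^-1)%:M (- 1%:M) (- 1%:M) gamma%:M.

Definition is_orth_proj (R : realType) (m : nat) (U : set 'cV[R]_m)
    (z w : 'cV[R]_m) : Prop :=
  U w /\ forall y, U y -> dot (z - w) y = 0.

Definition orth_proj (R : realType) (m : nat) (U : set 'cV[R]_m)
    (z : 'cV[R]_m) : 'cV[R]_m :=
  get [set w | is_orth_proj U z w].

Definition Pi_range (R : realType) (n : nat) (gamma : R) :
    'cV[R]_(n + n) -> 'cV[R]_(n + n) :=
  orth_proj (range (mulmx (Pmat n gamma) : 'cV[R]_(n + n) -> 'cV[R]_(n + n))).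

(* If 1 - 4 bD bP < 0 while negpart bD * negpart bP < 1/4, then bP and bD are
   both positive: the interval is ]0, +oo[ by the endpoint conventions, whatever
   the value of the square root.  If only pospart (- bP) = 0, the left endpoint
   is 0 automatically. *)
Definition stepsize_lo (R : realType) (bP bD : R) : \bar R :=
  (2 * pospart (- bP) / (1 + Num.sqrt (1 - 4 * bD * bP)))%:E.

Definition stepsize_hi (R : realType) (bP bD : R) : \bar R :=
  if pospart (- bD) == 0 then +oo%E
  else ((1 + Num.sqrt (1 - 4 * bD * bP)) / (2 * pospart (- bD)))%:E.

Definition stepsize_itv (R : realType) (bP bD : R) : set R :=
  [set g | (stepsize_lo bP bD < g%:E)%E /\ (g%:E < stepsize_hi bP bD)%E].

Definition DRS (R : realType) (n : nat) (A B : operator R n) (gamma : R)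
    (lambda : nat -> R) (u v s : nat -> 'cV[R]_n) : Prop :=
  forall k, [/\ resolvent (op_scale gamma A) (s k) (u k),
    resolvent (op_scale gamma B) (2 *: u k - s k) (v k)
    & s k.+1 = s k + lambda k *: (v k - u k)].

(* The image of a set of primal-dual pairs under (x, y) |-> x - gamma y. *)
Definition shadow (R : realType) (n : nat) (gamma : R)
    (S : set 'cV[R]_(n + n)) : set 'cV[R]_n :=
  [set usubmx z - gamma *: dsubmx z | z in S].

Definition pd_seq (R : realType) (n : nat) (gamma : R)
    (u s : nat -> 'cV[R]_n) : nat -> 'cV[R]_(n + n) :=
  fun k => col_mx (u k) (gamma^-1 *: (u k - s k)).

Lemma dotE (R : realType) (m : nat) (x y : 'cV[R]_m) :
  dot x y = (x^T *m y) ord0 ord0.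
Proof. by rewrite mxE; apply: eq_bigr => i _; rewrite mxE. Qed.

Lemma is_orth_proj_unique (R : realType) (m : nat) (M : 'M[R]_m)
    (z w w' : 'cV[R]_m) :
  is_orth_proj (range (mulmx M : 'cV[R]_m -> 'cV[R]_m)) z w ->
  is_orth_proj (range (mulmx M : 'cV[R]_m -> 'cV[R]_m)) z w' -> w = w'.
Proof.
move=> [[a _ <-] Hw] [[b _ <-] Hw'].
have /eqP : dot (M *m a - M *m b) (M *m a - M *m b) = 0.
  have Hd : range (mulmx M : 'cV[R]_m -> 'cV[R]_m) (M *m a - M *m b).
    by exists (a - b) => //; rewrite mulmxBr.
  move: (Hw _ Hd) (Hw' _ Hd); set d := (X in dot _ X) => h1 h2.
  have -> : dot d d = dot (z - M *m b) d - dot (z - M *m a) d.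
    rewrite -sumrB; apply: eq_bigr => i _; rewrite -mulrBl; congr (_ * _).
    rewrite mxE [(- (M *m b)) i _]mxE [(z - M *m b) i _]mxE.
    rewrite [(- (M *m b)) i _]mxE [(z - M *m a) i _]mxE [(- (M *m a)) i _]mxE.
    by rewrite opprB [RHS]addrC addrA subrK.
  by rewrite h1 h2 subrr.
rewrite psumr_eq0; last by move=> i _; rewrite -expr2 sqr_ge0.
move=> /allP H; apply/eqP; rewrite -subr_eq0; apply/eqP/matrixP => i j.
move: (H i (mem_index_enum _)) => /=.
by rewrite (ord1 j) mulf_eq0 orbb => /eqP ->; rewrite mxE.
Qed.

(* The projection onto range P exists, so the default value of [get] is never
   used. *)
Lemma Pi_rangeE (R : realType) (n : nat) (gamma : R) (z : 'cV[R]_(n + n)) :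
  0 < gamma ->
  Pi_range gamma z = (gamma + gamma^-1)^-1 *: (Pmat n gamma *m z).
Proof.
move=> g0; have c0 : gamma + gamma^-1 != 0.
  by rewrite lt0r_neq0 // addr_gt0 // invr_gt0.
have PT : (Pmat n gamma)^T = Pmat n gamma.
  by rewrite /Pmat tr_block_mx !linearN /= !tr_scalar_mx.
have PP : Pmat n gamma *m Pmat n gamma = (gamma + gamma^-1) *: Pmat n gamma.
  have gn : gamma != 0 by rewrite lt0r_neq0.
  rewrite /Pmat mulmx_block scale_block_mx !mulNmx !mulmxN !mul1mx !mulmx1.
  rewrite -!scalar_mxM !opprK !scalerN !scale_scalar_mx !mulr1.
  rewrite -!opprD -!raddfD /= !mulrDl mulfV // mulVf // -!expr2.
  by congr (block_mx _ (- _%:M) (- _%:M) _%:M);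
    rewrite addrC.
have Q : is_orth_proj
    (range (mulmx (Pmat n gamma) : 'cV[R]_(n + n) -> 'cV[R]_(n + n))) z
    ((gamma + gamma^-1)^-1 *: (Pmat n gamma *m z)).
  split; first by exists ((gamma + gamma^-1)^-1 *: z) => //; rewrite scalemxAr.
  move=> _ [y _ <-]; rewrite dotE mulmxA -[in X in _ *m X *m _]PT -trmx_mul.
  rewrite mulmxBr -scalemxAr mulmxA PP -scalemxAl scalerA mulVf // scale1r.
  by rewrite subrr trmx0 mul0mx mxE.
exact: is_orth_proj_unique (getPex (ex_intro _ _ Q)) Q.
Qed.

(* Main.v *)
Require Import Defs.
From mathcomp Require Import all_boot all_order all_algebra.
From mathcomp Require Import all_classical all_reals all_analysis.
From mathcomp Require Import ring lra.
Import Order.TTheory GRing.Theory Num.Theory.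
Import numFieldNormedType.Exports.
Local Open Scope classical_set_scope.
Local Open Scope ring_scope.
Set Implicit Arguments.
Unset Strict Implicit.
Unset Printing Implicit Defensive.

(** Write (x, y) for a point of R^(2n) and w^k = u^k - v^k.  The two resolvent
    inclusions say that a^k = (s^k - u^k) / gamma lies in A u^k and
    b^k = (2 u^k - s^k - v^k) / gamma lies in B v^k, so that the primal-dual
    operator contains (a^k + b^k, v^k - u^k) = (w^k / gamma, - w^k) over the
    point (u^k, b^k).  The weak Minty inequality there, against a solution with
    shadow ss = x - gamma y, collapses to
      alpha |w^k|^2 <= <w^k, s^k - ss>                    [drs_pairing],
    and expanding the square in s^(k+1) = s^k - lambda_k w^k gives the Fejer
    estimate
      |s^(k+1) - ss|^2 <=
        |s^k - ss|^2 - lambda_k (2 alpha - lambda_k) |w^k|^2   [fejer_step].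
    Its scalar consequences are that s^k is bounded, that w^k tends to 0
    [descent_cvg0], and the O(1/N) bound on the smallest residual
    [descent_bigmin].  The stepsize interval is where the quadratic
    gamma alpha = bD gamma^2 + gamma + bP is positive: its finite nonzero
    endpoints are roots of the quadratic [stepsize_alpha_gt0].

    Since the graphs of A and B are closed, any simultaneous limit of u^k and
    s^k produces a zero of the primal-dual operator [drs_limit_zer].  That
    settles the limit points of the pairs.  For a limit point of s^k alone,
    u^k might a priori escape to infinity, because A is not monotone; pairing
    (u^k, a^k) with the point of the graph of B provided by the solution itself
    bounds u^k - x quadratically by s^k - ss, again because alpha > 0
    [resolvent_linear_growth].  So u^k has a limit along a refinement of any
    filter along which s^k converges.

    If the projections of the solution set and of all zeros onto the range of P
    agree, then so do their shadows, because P (x, y) depends only on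
    x - gamma y and determines it [shadow_subset_of_Pi_range].  Every limit
    point of s^k is then a centre of Fejer monotonicity, and the sequence
    converges to it [fejer_cvg].

    Subsequences are replaced throughout by proper filters on the indices
    finer than the given one [cluster_refine, bounded_refine]. *)

(** * The Euclidean inner product *)

Lemma dotC (R : realType) m (x y : 'cV[R]_m) : dot x y = dot y x.
Proof. by apply: eq_bigr => i _; rewrite mulrC. Qed.

Lemma dotDl (R : realType) m (x y z : 'cV[R]_m) :
  dot (x + y) z = dot x z + dot y z.
Proof. by rewrite -big_split; apply: eq_bigr => i _; rewrite mxE mulrDl. Qed.

Lemma dotZl (R : realType) m (c : R) (x z : 'cV[R]_m) :
  dot (c *: x) z = c * dot x z.
Proof. by rewrite mulr_sumr; apply: eq_bigr => i _; rewrite mxE mulrA. Qed.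

Lemma dotNl (R : realType) m (x z : 'cV[R]_m) : dot (- x) z = - dot x z.
Proof. by rewrite -scaleN1r dotZl mulN1r. Qed.

Lemma dotDr (R : realType) m (x y z : 'cV[R]_m) :
  dot z (x + y) = dot z x + dot z y.
Proof. by rewrite dotC dotDl !(dotC z). Qed.

Lemma dotZr (R : realType) m (c : R) (x z : 'cV[R]_m) :
  dot z (c *: x) = c * dot z x.
Proof. by rewrite dotC dotZl (dotC z). Qed.

Lemma dotNr (R : realType) m (x z : 'cV[R]_m) : dot z (- x) = - dot z x.
Proof. by rewrite dotC dotNl (dotC z). Qed.

Lemma dotr0 (R : realType) m (x : 'cV[R]_m) : dot x 0 = 0.
Proof. by rewrite -[0 : 'cV_m](scale0r 0) dotZr mul0r. Qed.

Definition dot_bilin := (dotDl, dotDr, dotNl, dotNr, dotZl, dotZr).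

Lemma dot_ge0 (R : realType) m (x : 'cV[R]_m) : 0 <= dot x x.
Proof. by apply: sumr_ge0 => i _; rewrite -expr2 sqr_ge0. Qed.

Lemma sqr_coord_le_dot (R : realType) m (x : 'cV[R]_m) i :
  x i ord0 ^+ 2 <= dot x x.
Proof.
rewrite /dot (bigD1 i) //= -expr2 lerDl.
by apply: sumr_ge0 => j _; rewrite -expr2 sqr_ge0.
Qed.

Lemma sqr_enorm (R : realType) m (x : 'cV[R]_m) : enorm x ^+ 2 = dot x x.
Proof. by rewrite sqr_sqrtr ?dot_ge0. Qed.

Lemma dot_col_mx (R : realType) n (x y x' y' : 'cV[R]_n) :
  dot (col_mx x y) (col_mx x' y') = dot x x' + dot y y'.
Proof.
by rewrite /dot big_split_ord; congr (_ + _); apply: eq_bigr => i _;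
  rewrite ?col_mxEu ?col_mxEd.
Qed.

(** Cauchy-Schwarz in the form of Young's inequality, with a weight t to be
    absorbed into a coercive term. *)
Lemma dot_le_young (R : realType) m (t c : R) (x y : 'cV[R]_m) : 0 < t ->
  c * dot x y <= t / 2 * dot y y + c ^+ 2 / (2 * t) * dot x x.
Proof.
move=> t0; have := dot_ge0 (t *: y - c *: x).
rewrite !dot_bilin (dotC y x) => h.
have -> : t / 2 * dot y y + c ^+ 2 / (2 * t) * dot x x =
  c * dot x y + (t * (t * dot y y) - t * (c * dot x y) -
   c * (t * dot x y) + c * (c * dot x x)) / (2 * t).
  by field; rewrite gt_eqF.
by rewrite lerDl divr_ge0 ?mulr_ge0 ?(ltW t0) //; lra.
Qed.

Lemma dot_le_sub (R : realType) n (x y : 'cV[R]_n) :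
  dot x x <= 2 * dot (x - y) (x - y) + 2 * dot y y.
Proof.
by have := dot_ge0 (x - 2 *: y); rewrite !dot_bilin (dotC y x); lra.
Qed.

(** * Convergence of matrices, and refinement of filters *)

Lemma cvg_coord (R : realType) m n (I : Type) (F : set_system I) (FF : Filter F)
    (f : I -> 'M[R]_(m, n)) (l : 'M[R]_(m, n)) :
  (forall i j, (fun t => f t i j) @ F --> l i j) -> f @ F --> l.
Proof.
move=> h; apply/cvg_ballP => e e0.
near=> t; split=> // i j.
move: i j; near: t.
apply: filter_forall => i; apply: filter_forall => j.
exact: (cvg_ball (h i j) e0).
Unshelve. all: end_near. Qed.

Lemma coord_cvg (R : realType) m n (I : Type) (F : set_system I) (FF : Filter F)
    (f : I -> 'M[R]_(m, n)) (l : 'M[R]_(m, n)) i j :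
  f @ F --> l -> (fun t => f t i j) @ F --> l i j.
Proof. by move=> h; apply: (cvg_comp _ _ h (@coord_continuous _ _ _ i j l)). Qed.

Lemma cvg_trmx (R : realType) m n (I : Type) (F : set_system I) (FF : Filter F)
    (f : I -> 'M[R]_(m, n)) (l : 'M[R]_(m, n)) :
  f @ F --> l -> (fun t => (f t)^T) @ F --> l^T.
Proof.
move=> h; apply: cvg_coord => i j; rewrite mxE.
by under eq_fun do rewrite mxE; exact: coord_cvg.
Qed.

Lemma cvg_usubmx (R : realType) m1 m2 n (I : Type) (F : set_system I)
    (FF : Filter F) (f : I -> 'M[R]_(m1 + m2, n)) (l : 'M[R]_(m1 + m2, n)) :
  f @ F --> l -> (fun t => usubmx (f t)) @ F --> usubmx l.
Proof.
move=> h; apply: cvg_coord => i j; rewrite mxE.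
by under eq_fun do rewrite mxE; exact: coord_cvg.
Qed.

Lemma cvg_dsubmx (R : realType) m1 m2 n (I : Type) (F : set_system I)
    (FF : Filter F) (f : I -> 'M[R]_(m1 + m2, n)) (l : 'M[R]_(m1 + m2, n)) :
  f @ F --> l -> (fun t => dsubmx (f t)) @ F --> dsubmx l.
Proof.
move=> h; apply: cvg_coord => i j; rewrite mxE.
by under eq_fun do rewrite mxE; exact: coord_cvg.
Qed.

Lemma cvg_col_mx (R : realType) m1 m2 n (I : Type) (F : set_system I)
    (FF : Filter F) (f : I -> 'M[R]_(m1, n)) (g : I -> 'M[R]_(m2, n))
    (x : 'M[R]_(m1, n)) (y : 'M[R]_(m2, n)) :
  f @ F --> x -> g @ F --> y ->
  (fun t => col_mx (f t) (g t)) @ F --> col_mx x y.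
Proof.
move=> hf hg; apply: cvg_coord => i j; rewrite mxE.
under eq_fun do rewrite mxE.
by case: (fintype.split i) => k; exact: coord_cvg.
Qed.

(** The topology comes from the sup norm; this is the bridge to the Euclidean
    distances in which all the estimates are expressed. *)
Lemma cvg_dot_sub (R : realType) m (I : Type) (F : set_system I)
    (FF : Filter F) (f : I -> 'cV[R]_m) (l : 'cV[R]_m) :
  (fun t => dot (f t - l) (f t - l)) @ F --> (0 : R) <-> f @ F --> l.
Proof.
split=> h.
  apply/cvg_ballP => e e0.
  have := cvgr_lt _ h (e ^+ 2); rewrite exprn_gt0 // => /(_ FF isT).
  apply: filterS => t ht; split=> // i j.
  rewrite /ball /= (ord1 j) distrC -(@ltr_pXn2r _ 2) ?nnegrE ?(ltW e0) //.
  rewrite real_normK ?num_real //.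
  by apply: le_lt_trans ht; rewrite (le_trans _ (sqr_coord_le_dot _ i)) // !mxE.
have -> : (0 : R) = \sum_(i < m) (l i ord0 - l i ord0) * (l i ord0 - l i ord0).
  by rewrite big1 // => i _; rewrite subrr mul0r.
rewrite /dot; apply: cvg_big => [|i _]; first exact: add_continuous.
under eq_fun do rewrite !mxE.
by apply: cvgM; (apply: cvgB; [exact: coord_cvg|exact: cvg_cst]).
Qed.

(** A filter version of the extraction of a convergent subsequence: the
    refinement is generated by the sets V `&` f @^-1` W with V in F and W a
    neighbourhood of l, which are nonempty exactly because l is a cluster
    point.  It lives on the index type, so that other sequences with the same
    indices can be followed along it. *)
Lemma cluster_refine (I : Type) (T : topologicalType) (F : set_system I)
    (FF : ProperFilter F) (f : I -> T) l :
  cluster (f @ F) l ->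
  exists G : set_system I, [/\ ProperFilter G, F `<=` G & f @ G --> l].
Proof.
move=> cl.
pose G : set_system I :=
  [set E | exists V W, [/\ F V, nbhs l W & V `&` f @^-1` W `<=` E]].
have clN V W : F V -> nbhs l W -> V `&` f @^-1` W !=set0.
  move=> FV nW; have fV : (f @ F) (f @` V).
    by rewrite fmapE; apply: filterS FV => x Vx; exists x.
  by have [_ [[x Vx <-] Wx]] := cl _ _ fV nW; exists x.
exists G; split; first split.
- move=> [V [W [FV nW sub]]]; have [x /sub] := clN _ _ FV nW; exact.
- split.
  + by exists setT, setT; split => //; exact: filterT.
  + move=> P Q [V [W [FV nW s1]]] [V' [W' [FV' nW' s2]]].
    exists (V `&` V'), (W `&` W').
    split; [exact: filterI|exact: filterI|].
    by move=> x [[Vx V'x] [Wx W'x]]; split; [exact: s1|exact: s2].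
  + move=> P Q PQ [V [W [FV nW s1]]]; exists V, W; split => //.
    exact: subset_trans PQ.
- by move=> V FV; exists V, setT; split => [||x []//]; [|exact: filterT].
- move=> W nW; change (G (f @^-1` W)).
  by exists setT, W; split => [||x []//]; [exact: filterT|].
Qed.

(** Bolzano-Weierstrass: closed balls of row vectors are compact, and
    transposition carries this over to column vectors. *)
Lemma bounded_refine (R : realType) m (I : Type) (F : set_system I)
    (FF : ProperFilter F) (f : I -> 'cV[R]_m) (M : R) :
  (forall t, dot (f t) (f t) <= M) ->
  exists (G : set_system I) (l : 'cV[R]_m),
    [/\ ProperFilter G, F `<=` G & f @ G --> l].
Proof.
move=> fM; pose A := [set x : 'rV[R]_m | `|x| <= M + 1].
have cA : compact A.
  apply: bounded_closed_compact.
    exists (M + 1); split; first exact: num_real.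
    by move=> r /ltW Mr x /= /le_trans; apply.
  apply: (@closed_comp _ _ (fun x : 'rV[R]_m => `|x|) [set r | r <= M + 1]).
    by move=> x _; exact: norm_continuous.
  exact: closed_le.
have fA : ((fun t => (f t)^T) @ F) A.
  rewrite fmapE; apply: nearW => t /=; have M0 := le_trans (dot_ge0 _) (fM t).
  rewrite /A /= [leLHS]/Num.norm /= mx_normrE.
  apply: bigmax_le => [|[i j] _] /=; first by rewrite addr_ge0.
  rewrite mxE (ord1 i) -(@ler_pXn2r _ 2) ?nnegrE ?addr_ge0 //.
  rewrite real_normK ?num_real //.
  (* M <= (M + 1)^2, so M + 1 serves as a radius without square roots. *)
  apply: le_trans (sqr_coord_le_dot _ _) _; apply: le_trans (fM t) _.
  rewrite sqrrD1; nra.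
have [l [_ /cluster_refine[G [PG FG fG]]]] := cA _ _ fA.
exists G, l^T; split => //.
have -> : f = fun t => ((f t)^T)^T by apply/funext => t; rewrite trmxK.
exact: cvg_trmx.
Qed.

(** * Scalar descent inequalities *)

Lemma limn_einf_gt0_near (R : realType) (c : nat -> R) :
  (0 < limn_einf (fun k => (c k)%:E))%E ->
  exists2 e, 0 < e & \forall k \near \oo, e <= c k.
Proof.
rewrite limn_einf_lim (cvg_lim _ (@cvg_einfs_sup _ _)) //.
move=> /ereal_sup_gt[_ [N _ <-]].
set I := einfs _ N => I0.
have Ile k : (N <= k)%N -> (I <= (c k)%:E)%E.
  by move=> Nk; apply: ereal_inf_lbound; exists k.
case: I I0 Ile => [r||] // r0 Ile; last by have := Ile _ (leqnn N).
exists r; first by rewrite lte_fin in r0.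
by exists N => // k /= /Ile; rewrite lee_fin.
Qed.

(** D decreases to a limit, so its increments vanish; eventually c is bounded
    away from 0, so W is dominated by a multiple of those increments. *)
Lemma descent_cvg0 (R : realType) (D W c : nat -> R) :
  (forall k, 0 <= D k) -> (forall k, 0 <= W k) -> (forall k, 0 <= c k) ->
  (forall k, D k.+1 <= D k - c k * W k) ->
  (0 < limn_einf (fun k => (c k)%:E))%E ->
  W @ \oo --> (0 : R).
Proof.
move=> D0 W0 c0 desc /limn_einf_gt0_near[e e0 ec].
have Dni : nonincreasing_seq D.
  apply/nonincreasing_seqP => k; apply: le_trans (desc k) _.
  by rewrite lerBlDr lerDl mulr_ge0.
have cD : cvgn D.
  by apply: nonincreasing_is_cvgn => //; exists 0 => _ [k _ <-].
have cDS : (fun k => e^-1 * (D k - D k.+1)) @ \oo --> (0 : R).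
  rewrite -[X in _ --> X](mulr0 e^-1) -[X in _ * X](subrr (limn D)).
  apply: cvgM; first exact: cvg_cst.
  by apply: cvgB => //; rewrite (cvg_shiftS D).
apply: squeeze_cvgr cDS; last exact: cvg_cst.
near=> k; rewrite W0 /= mulrC ler_pdivlMr // mulrC.
have := desc k; have : e <= c k by near: k.
by have := W0 k; nra.
Unshelve. all: end_near. Qed.

Lemma descent_sum (R : realType) (D W c : nat -> R) :
  (forall k, D k.+1 <= D k - c k * W k) ->
  forall N, D N + \sum_(0 <= k < N) c k * W k <= D 0%N.
Proof.
move=> desc; elim=> [|N IH]; first by rewrite big_geq ?addr0.
by rewrite big_nat_recr //=; have := desc N; move: IH; lra.
Qed.

(** The smallest of N + 1 terms is at most their average, which the telescoped
    descent inequality controls. *)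
Lemma descent_bigmin (R : realType) (D W c : nat -> R) (kappa : R) :
  (forall k, 0 <= D k) -> (forall k, 0 <= W k) ->
  (forall k, D k.+1 <= D k - c k * W k) ->
  0 < kappa -> (forall k, kappa <= c k) ->
  forall N, \big[Num.min/W 0%N]_(0 <= k < N.+1) W k <=
    D 0%N / (N.+1%:R * kappa).
Proof.
move=> D0 W0 desc k0 kc N; set m := \big[_/_]_(_ <= _ < _) _.
have mle k : (k < N.+1)%N -> m <= W k.
  by move=> kN; rewrite /m ge_bigmin_seq ?mem_index_iota.
have : \sum_(0 <= k < N.+1) kappa * m <= D 0%N.
  apply: le_trans (descent_sum desc N.+1); rewrite -[leLHS]add0r lerD //.
  rewrite !big_mkord; apply: ler_sum => i _.
  apply: le_trans (_ : kappa * W i <= _); first by rewrite ler_pM2l // mle.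
  by rewrite ler_wpM2r.
rewrite sumr_const_nat subn0 -[leLHS]mulr_natl mulrA => h.
by rewrite ler_pdivlMr 1?mulrC // mulr_gt0 ?ltr0n.
Qed.

(** * The stepsize interval *)

Lemma negpart_ge0 (R : realType) (t : R) : 0 <= t -> negpart t = 0.
Proof. by move=> t0; rewrite /negpart min_l. Qed.

Lemma negpart_lt0 (R : realType) (t : R) : t < 0 -> negpart t = t.
Proof. by move=> t0; rewrite /negpart min_r // ltW. Qed.

Lemma pospartN_ge0 (R : realType) (t : R) : 0 <= t -> pospart (- t) = 0.
Proof. by move=> t0; rewrite /pospart max_l // oppr_le0. Qed.

Lemma pospartN_lt0 (R : realType) (t : R) : t < 0 -> pospart (- t) = - t.
Proof. by move=> t0; rewrite /pospart max_r // oppr_ge0 ltW. Qed.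

(** Clearing denominators makes the endpoint conventions automatic: a vanishing
    positive part turns the corresponding bound into 0 < gamma (1 + r) or
    0 < 1 + r. *)
Lemma stepsize_itvP (R : realType) (bP bD g : R) :
  let r := Num.sqrt (1 - 4 * bD * bP) in
  stepsize_itv bP bD g <->
  2 * pospart (- bP) < g * (1 + r) /\ 2 * pospart (- bD) * g < 1 + r.
Proof.
move=> r; have r0 : 0 < 1 + r by rewrite ltr_pwDl // sqrtr_ge0.
rewrite /stepsize_itv /stepsize_lo /stepsize_hi /= lte_fin ltr_pdivrMr //.
case: ifPn => [/eqP -> | pD].
  by rewrite mulr0 mul0r ltry; split=> -[].
have D0 : 0 < pospart (- bD).
  by rewrite lt_neqAle eq_sym pD /pospart le_max lexx.
by rewrite lte_fin ltr_pdivlMr ?mulr_gt0 // (mulrC g (2 * _)).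
Qed.

Lemma stepsize_itv_nonempty (R : realType) (bP bD : R) :
  negpart bD * negpart bP < 4^-1 -> stepsize_itv bP bD !=set0.
Proof.
move=> h; set r := Num.sqrt (1 - 4 * bD * bP).
have r0 : 0 <= r by exact: sqrtr_ge0.
have [D0|D0] := leP 0 bD.
  exists (2 * pospart (- bP) / (1 + r) + 1); apply/stepsize_itvP.
  rewrite -/r (pospartN_ge0 D0) [X in _ < X]mulrDl divfK; first by split; lra.
  by rewrite lt0r_neq0 //; lra.
have [P0|P0] := leP 0 bP.
  exists ((1 + r) / (4 * - bD)); apply/stepsize_itvP.
  rewrite (pospartN_ge0 P0) (pospartN_lt0 D0) -/r mulr0; split.
    by rewrite !mulr_gt0 ?invr_gt0 //; lra.
  have -> : 2 * - bD * ((1 + r) / (4 * - bD)) = (1 + r) / 2 by field; lra.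
  lra.
move: h; rewrite !negpart_lt0 // => h.
have hlt : 2 * - bP / (1 + r) < (1 + r) / (2 * - bD).
  rewrite ltr_pdivrMr; last by lra.
  rewrite mulrAC ltr_pdivlMr; last by lra.
  have -> : (1 + r) * (1 + r) = 1 + 2 * r + r ^+ 2 by ring.
  by rewrite (_ : _ * _ = 4 * (bD * bP)); [nra|ring].
exists ((2 * - bP / (1 + r) + (1 + r) / (2 * - bD)) / 2).
rewrite /stepsize_itv /stepsize_lo /stepsize_hi /= !pospartN_lt0 // -/r.
by rewrite oppr_eq0 (lt_eqF D0) !lte_fin !(midf_lt hlt).
Qed.

(** The left endpoint - 2 bP / (1 + r), with r the root of the discriminant,
    is the positive root (r - 1) / (2 bD) of the convex quadratic
    bD t^2 + t + bP, in the form that still makes sense for bD = 0. *)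
Lemma quadratic_gt0_above_root (R : realType) (bP bD g : R) :
  0 < g -> bP < 0 -> 0 <= bD ->
  - 2 * bP < g * (1 + Num.sqrt (1 - 4 * bD * bP)) ->
  0 < bD * g ^+ 2 + g + bP.
Proof.
move=> g0 P0 D0; set r := Num.sqrt _ => lo.
have r0 : 0 <= r by exact: sqrtr_ge0.
have r2 : r ^+ 2 = 1 - 4 * bD * bP by rewrite sqr_sqrtr //; nra.
have r1 : 0 < (1 + r) ^+ 2 by rewrite exprn_gt0 //; lra.
rewrite -(pmulr_lgt0 _ r1).
have h1 : (- 2 * bP) ^+ 2 <= (g * (1 + r)) ^+ 2.
  by rewrite lerXn2r ?nnegrE ?(ltW lo) //; [nra|nra].
have h2 : bD * (- 2 * bP) ^+ 2 <= bD * (g * (1 + r)) ^+ 2 by rewrite ler_wpM2l.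
have h3 : (1 + r) * (- 2 * bP) < (1 + r) * (g * (1 + r)).
  by rewrite ltr_pM2l //; lra.
have h4 : bD * (- 2 * bP) ^+ 2 = bP * (1 - r ^+ 2) by rewrite r2; ring.
(* The two bounds on (1 + r)^2 bD g^2 and (1 + r)^2 g sum to - bP (1 + r)^2. *)
move: h2 h3; rewrite h4 => h2 h3; lra.
Qed.

(** When only bP is negative, the quadratic lemma applies to
    gamma alpha = bD gamma^2 + gamma + bP; when only bD is, it applies to
    alpha / gamma, a quadratic in 1 / gamma with bP and bD exchanged.  When
    both are negative, gamma lies between the roots of a concave quadratic. *)
Lemma stepsize_alpha_gt0 (R : realType) (bP bD g : R) :
  0 < g -> negpart bD * negpart bP < 4^-1 -> stepsize_itv bP bD g ->
  0 < 1 + g^-1 * bP + g * bD.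
Proof.
move=> g0 h /stepsize_itvP; set r := Num.sqrt (1 - 4 * bD * bP) => -[lo hi].
have r0 : 0 <= r by exact: sqrtr_ge0.
have eq1 : 1 + g^-1 * bP + g * bD = g^-1 * (bD * g ^+ 2 + g + bP).
  by field; rewrite lt0r_neq0.
have eq2 : 1 + g^-1 * bP + g * bD = g * (bP * g^-1 ^+ 2 + g^-1 + bD).
  by field; rewrite lt0r_neq0.
have g1 : 0 < g^-1 by rewrite invr_gt0.
have [D0|D0] := leP 0 bD; have [P0|P0] := leP 0 bP.
- by rewrite -addrA ltr_pwDl // addr_ge0 // mulr_ge0 // ltW.
- rewrite eq1 mulr_gt0 //; apply: quadratic_gt0_above_root => //.
  by move: lo; rewrite (pospartN_lt0 P0) mulrN mulNr.
- rewrite eq2 mulr_gt0 //; apply: quadratic_gt0_above_root => //.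
  rewrite [4 * bP * bD]mulrAC -/r ltr_pdivlMl //.
  by move: hi; rewrite (pospartN_lt0 D0) mulrN mulNr mulrC.
rewrite eq1 mulr_gt0 //.
move: h lo hi; rewrite !negpart_lt0 // !pospartN_lt0 // => h lo hi.
have r2 : r ^+ 2 = 1 - 4 * bD * bP by rewrite sqr_sqrtr //; nra.
(* 4 bD (bD g^2 + g + bP) = (2 bD g + 1)^2 - r^2; its two factors have
   opposite signs. *)
have h1 : 0 < 2 * bD * g + 1 + r by lra.
have h2 : 2 * bD * g + 1 - r < 0.
  have : (2 * bD) * (g * (1 + r)) < (2 * bD) * (2 * - bP).
    by rewrite ltr_nM2l //; lra.
  have -> : (2 * bD) * (2 * - bP) = (r - 1) * (1 + r).
    by rewrite (_ : (r - 1) * _ = r ^+ 2 - 1); [rewrite r2; ring|ring].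
  by rewrite mulrA ltr_pM2r; lra.
have : 0 > (2 * bD * g + 1 + r) * (2 * bD * g + 1 - r) by rewrite pmulr_rlt0.
have -> : (2 * bD * g + 1 + r) * (2 * bD * g + 1 - r) =
    (4 * bD) * (bD * g ^+ 2 + g + bP).
  rewrite (_ : _ * _ = (2 * bD * g + 1) ^+ 2 - r ^+ 2); last by ring.
  by rewrite r2; ring.
by rewrite nmulr_rlt0 //; lra.
Qed.

(** * The primal-dual operator and the weak Minty inequality *)

Lemma resolvent_scaleP (R : realType) m (g : R) (T : operator R m) s u :
  g != 0 -> resolvent (op_scale g T) s u <-> T u (g^-1 *: (s - u)).
Proof.
move=> g0; split.
  move=> [_ -> [_ [a Ta <-] <-]].
  by rewrite addrAC subrr add0r scalerA mulVf // scale1r.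
move=> Tu; exists u => //; exists (s - u); last by rewrite addrCA subrr addr0.
by exists (g^-1 *: (s - u)) => //; rewrite scalerA divff // scale1r.
Qed.

Lemma zer_primal_dualP (R : realType) n (A B : operator R n) z :
  zer (primal_dual A B) z <->
  A (usubmx z) (- dsubmx z) /\ B (usubmx z) (dsubmx z).
Proof.
split.
  move=> [_ [a Aa [_ -> <-]]] [_ [q Bq [_ -> <-]]] h0.
  have /eq_col_mx[/eqP + /eqP] :
      col_mx (a + dsubmx z) (q - usubmx z) = col_mx 0 0.
    by rewrite col_mx0.
  rewrite addr_eq0 subr_eq0 => /eqP ea /eqP eq.
  by rewrite -ea -[in B _ _]eq.
move=> [Az Bz]; exists 0.
  by exists (- dsubmx z) => //; exists (dsubmx z) => //; rewrite addNr.
exists 0; last by rewrite col_mx0.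
by exists (usubmx z) => //; exists (- usubmx z) => //; rewrite subrr.
Qed.

Lemma gph_primal_dual (R : realType) n (A B : operator R n) x a x' b :
  A x a -> B x' b ->
  gph (primal_dual A B) (col_mx x b, col_mx (a + b) (x' - x)).
Proof.
move=> Axa Bxb; rewrite /gph /primal_dual /= col_mxKu col_mxKd.
exists (a + b); first by exists a => //; exists b.
by exists (x' - x) => //; exists x' => //; exists (- x).
Qed.

Lemma weak_minty_primal_dual (R : realType) n (A B : operator R n) S bP bD
    zs x a x' b :
  oblique_weak_minty (Vmat n bP bD) (primal_dual A B) S -> S zs ->
  A x a -> B x' b ->
  bP * dot (a + b) (a + b) + bD * dot (x' - x) (x' - x) <=
  dot (a + b) (x - usubmx zs) + dot (x' - x) (b - dsubmx zs).
Proof.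
move=> [_ _ _ minty] Szs Axa Bxb.
have := minty _ _ _ Szs (gph_primal_dual Axa Bxb).
rewrite -{1}(vsubmxK zs) opp_col_mx add_col_mx dot_col_mx /Vmat mul_block_col.
by rewrite !mul_scalar_mx !mul0mx addr0 add0r dot_col_mx !dotZr.
Qed.

(** The dual component at which weak Minty is applied is the element of B v
    produced by the second resolvent.  For this choice the primal and dual
    components of the operator value are multiples of the same vector u - v,
    so V enters only through bP / gamma + gamma bD = alpha - 1. *)
Lemma drs_pairing (R : realType) n (A B : operator R n) (gamma : R) S bP bD
    zs s u v :
  0 < gamma ->
  oblique_weak_minty (Vmat n bP bD) (primal_dual A B) S -> S zs ->
  resolvent (op_scale gamma A) s u ->
  resolvent (op_scale gamma B) (2 *: u - s) v ->
  (1 + gamma^-1 * bP + gamma * bD) * dot (u - v) (u - v) <=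
  dot (u - v) (s - (usubmx zs - gamma *: dsubmx zs)).
Proof.
move=> g0 minty Szs; have gn := lt0r_neq0 g0.
move=> /(resolvent_scaleP _ _ _ gn) Au /(resolvent_scaleP _ _ _ gn) Bv.
have := weak_minty_primal_dual minty Szs Au Bv.
set w := u - v; set y := dsubmx zs; set x := usubmx zs.
have -> : gamma^-1 *: (s - u) + gamma^-1 *: (2 *: u - s - v) = gamma^-1 *: w.
  rewrite -scalerDr /w; congr (_ *: _).
  by apply/matrixP => i j; rewrite !mxE; ring.
have -> : v - u = - w by rewrite opprB.
have -> : gamma^-1 *: (2 *: u - s - v) - y =
    gamma^-1 *: (u - s + w - gamma *: y).
  by apply/matrixP => i j; rewrite /w !mxE; field.
rewrite !dot_bilin -(ler_pM2l g0) -subr_ge0 => h.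
rewrite -subr_ge0; apply: le_trans h _; rewrite le_eqVlt; apply/orP; left.
by apply/eqP; field.
Qed.

(** Let (x, y) be the solution.  Weak Minty is applied at the point (u, y), B
    contributing the pair (x, y) of its graph: with d = u - x and
    e = s - (x - gamma y) it reads
    alpha |d|^2 <= (1 + 2 bP / gamma) <e, d> - (bP / gamma) |e|^2.  As
    alpha > 0, Young's inequality absorbs the cross term. *)
Lemma resolvent_linear_growth (R : realType) n (A B : operator R n) (gamma : R)
    S bP bD zs :
  0 < gamma -> 0 < 1 + gamma^-1 * bP + gamma * bD ->
  oblique_weak_minty (Vmat n bP bD) (primal_dual A B) S -> S zs ->
  exists2 K, 0 <= K & forall s u, resolvent (op_scale gamma A) s u ->
  dot (u - usubmx zs) (u - usubmx zs) <=
  K * dot (s - (usubmx zs - gamma *: dsubmx zs))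
          (s - (usubmx zs - gamma *: dsubmx zs)).
Proof.
set alpha := (1 + _ + _) => g0 a0 minty Szs; have gn := lt0r_neq0 g0.
have [_ Bz] : A (usubmx zs) (- dsubmx zs) /\ B (usubmx zs) (dsubmx zs).
  by case: (minty) => _ _ sub _; apply/zer_primal_dualP/sub.
pose p := gamma^-1 * bP.
pose K := 2 / alpha * ((1 + 2 * p) ^+ 2 / (2 * alpha) - p).
exists `|K| => // s u /(resolvent_scaleP _ _ _ gn) Au.
have := weak_minty_primal_dual minty Szs Au Bz.
set y := dsubmx zs; set x := usubmx zs.
set d := u - x; set e := s - (x - gamma *: y).
have -> : gamma^-1 *: (s - u) + y = gamma^-1 *: (e - d).
  by apply/matrixP => i j; rewrite /e /d !mxE; field.
have -> : x - u = - d by rewrite opprB.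
clearbody d e.
rewrite subrr dotr0 !dot_bilin (dotC d e) addr0 -(ler_pM2l g0) -subr_ge0 => h.
have {h} main : alpha * dot d d <= (1 + 2 * p) * dot e d - p * dot e e.
  rewrite -subr_ge0; apply: le_trans h _; rewrite le_eqVlt; apply/orP; left.
  by apply/eqP; rewrite /alpha /p; field.
have yg := dot_le_young (1 + 2 * p) e d a0.
apply: le_trans (_ : K * dot e e <= _); last first.
  by rewrite ler_wpM2r ?dot_ge0 ?ler_norm.
have h2 : alpha / 2 * dot d d <= ((1 + 2 * p) ^+ 2 / (2 * alpha) - p) * dot e e.
  by move: main yg; lra.
rewrite /K -mulrA -ler_pdivrMl ?divr_gt0 // invf_div.
exact: h2.
Qed.

(** * Fejer monotonicity and limits of the Douglas-Rachford iteration *)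

Lemma fejer_step (R : realType) n (lambda alpha : R) (s ss w : 'cV[R]_n) :
  0 < lambda -> alpha * dot w w <= dot w (s - ss) ->
  dot (s - lambda *: w - ss) (s - lambda *: w - ss) <=
  dot (s - ss) (s - ss) - lambda * (2 * alpha - lambda) * dot w w.
Proof.
move=> l0 h; rewrite (addrAC s); set d := s - ss in h *; clearbody d.
rewrite !dot_bilin (dotC d w).
have : lambda * (alpha * dot w w) <= lambda * dot w d by rewrite ler_pM2l.
lra.
Qed.

Lemma drs_fixed_zer (R : realType) n (A B : operator R n) (gamma : R) s u :
  gamma != 0 ->
  resolvent (op_scale gamma A) s u ->
  resolvent (op_scale gamma B) (2 *: u - s) u ->
  zer (primal_dual A B) (col_mx u (gamma^-1 *: (u - s))).
Proof.
move=> g0 /(resolvent_scaleP _ _ _ g0) Au /(resolvent_scaleP _ _ _ g0) Bu.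
apply/zer_primal_dualP; rewrite col_mxKu col_mxKd -scalerN opprB; split=> //.
have -> // : u - s = 2 *: u - s - u by apply/matrixP => i j; rewrite !mxE; ring.
Qed.

(** As u - v vanishes, v has the same limit as u, and the elements of A u and
    B v selected by the resolvents converge to opposite vectors. *)
Lemma drs_limit_zer (R : realType) n (A B : operator R n) (gamma : R)
    (lambda : nat -> R) (u v s : nat -> 'cV[R]_n) (G : set_system nat)
    (x l : 'cV[R]_n) :
  ProperFilter G -> gamma != 0 ->
  outer_semicontinuous A -> outer_semicontinuous B ->
  DRS A B gamma lambda u v s ->
  (fun k => u k - v k) @ G --> (0 : 'cV[R]_n) -> u @ G --> x -> s @ G --> l ->
  zer (primal_dual A B) (col_mx x (gamma^-1 *: (x - l))).
Proof.
move=> PG g0 oA oB drs w0 ux sl.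
have vx : v @ G --> x.
  have -> : v = fun k => u k - (u k - v k).
    by apply/funext => k; rewrite opprB addrC subrK.
  by rewrite -[X in _ --> X]subr0; apply: cvgB.
apply/zer_primal_dualP; rewrite col_mxKu col_mxKd -scalerN opprB; split.
  change (gph A (x, gamma^-1 *: (l - x))).
  apply: (closed_cvg (gph A) oA (F := G)
    (u_ := fun k => (u k, gamma^-1 *: (s k - u k)))).
    by apply: nearW => k; have [/(resolvent_scaleP _ _ _ g0)] := drs k.
  have cA : (fun k => gamma^-1 *: (s k - u k)) @ G --> gamma^-1 *: (l - x).
    by apply: cvgZr; exact: cvgB.
  exact: (cvg_pair ux cA).
have -> : x - l = 2 *: x - l - x by apply/matrixP => i j; rewrite !mxE; ring.
change (gph B (x, gamma^-1 *: (2 *: x - l - x))).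
apply: (closed_cvg (gph B) oB
  (F := G) (u_ := fun k => (v k, gamma^-1 *: (2 *: u k - s k - v k)))).
  by apply: nearW => k; have [_ /(resolvent_scaleP _ _ _ g0)] := drs k.
have cB : (fun k => gamma^-1 *: (2 *: u k - s k - v k)) @ G -->
    gamma^-1 *: (2 *: x - l - x).
  by apply: cvgZr; apply: cvgB => //; apply: cvgB => //; exact: cvgZr.
exact: (cvg_pair vx cB).
Qed.

(** The second block of P (x, y) is - (x - gamma y). *)
Lemma shadow_subset_of_Pi_range (R : realType) n (gamma : R)
    (S T : set 'cV[R]_(n + n)) :
  0 < gamma -> Pi_range gamma @` T `<=` Pi_range gamma @` S ->
  shadow gamma T `<=` shadow gamma S.
Proof.
move=> g0 sub _ [z Tz <-].
have [|z' Sz'] := sub (Pi_range gamma z); first by exists z.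
rewrite !Pi_rangeE // => /(congr1 (GRing.scale (gamma + gamma^-1))).
have c0 : gamma + gamma^-1 != 0 by rewrite lt0r_neq0 // addr_gt0 // invr_gt0.
rewrite !scalerA divff // !scale1r -{1}(vsubmxK z) -{1}(vsubmxK z').
rewrite /Pmat !mul_block_col !mulNmx !mul1mx !mul_scalar_mx => /eq_col_mx[_ e].
by exists z' => //; apply: oppr_inj; rewrite !opprB addrC e addrC.
Qed.

(** Opial's argument: the distances to l decrease and come arbitrarily close to
    0 along G. *)
Lemma fejer_cvg (R : realType) n (s : nat -> 'cV[R]_n) (G : set_system nat)
    (l : 'cV[R]_n) :
  ProperFilter G -> s @ G --> l ->
  nonincreasing_seq (fun k => dot (s k - l) (s k - l)) ->
  s @ \oo --> l.
Proof.
move=> PG /cvg_dot_sub sG ni; apply/cvg_dot_sub.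
apply/cvgr0Pnorm_lt => e e0.
have [k ke] := filter_ex (cvgr_lt _ sG e e0).
exists k => // m /= km; rewrite ger0_norm ?dot_ge0 //.
by apply: le_lt_trans ke; exact: ni.
Qed.

(** * Convergence of Douglas-Rachford splitting *)

Theorem theorem3p3 (R : realType) (n : nat) (A B : operator R n) (gamma : R)
  (gamma_gt0 : 0 < gamma)
  (oscA : outer_semicontinuous A) (oscB : outer_semicontinuous B)
  (domJA : dom (resolvent (op_scale gamma A)) = setT)
  (domJB : dom (resolvent (op_scale gamma B)) = setT)
  (Sstar : set 'cV[R]_(n + n)) (bP bD : R)
  (bPD : negpart bD * negpart bP < 4^-1)
  (minty : oblique_weak_minty (Vmat n bP bD) (primal_dual A B) Sstar) :
  let zerPD := zer (primal_dual A B) in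
  let alpha := 1 + gamma^-1 * bP + gamma * bD in
  stepsize_itv bP bD !=set0 /\
  (stepsize_itv bP bD gamma ->
   0 < alpha /\
   forall (lambda : nat -> R) (u v s : nat -> 'cV[R]_n),
     (forall k, 0 < lambda k < 2 * alpha) ->
     (0 < limn_einf (fun k => (lambda k * (2 * alpha - lambda k))%:E))%E ->
     DRS A B gamma lambda u v s ->
     (forall k, u k = v k -> zerPD (pd_seq gamma u s k)) /\
     ((exists k, u k = v k) \/
      [/\ (* (i) *)
          (forall k, minkowski_sum (A (u k)) (B (v k))
                       (gamma^-1 *: (u k - v k))) /\
          (fun k => u k - v k) @ \oo --> (0 : 'cV[R]_n),
          (* (ii) *)
          cluster (pd_seq gamma u s @ \oo) `<=` zerPD,
          (* (iii) *)
          (exists M : R, forall k, enorm (s k) <= M) /\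
          cluster (s @ \oo) `<=` shadow gamma zerPD,
          (* (iv) *)
          (forall kappa : R, 0 < kappa ->
             (forall k, kappa <= lambda k * (2 * alpha - lambda k)) ->
             forall ss, shadow gamma Sstar ss -> forall N : nat,
               \big[Num.min/enorm (u 0%N - v 0%N) ^+ 2]_(0 <= k < N.+1)
                 enorm (u k - v k) ^+ 2
               <= enorm (s 0%N - ss) ^+ 2 / (N.+1%:R * kappa))
        & (* (v) *)
          (Pi_range gamma @` Sstar = Pi_range gamma @` zerPD ->
             (exists2 l, shadow gamma zerPD l & s @ \oo --> l) /\
             (single_valued_continuous (resolvent (op_scale gamma A)) ->
              single_valued_continuous (resolvent (op_scale gamma B)) ->
              exists2 z, zerPD z & pd_seq gamma u s @ \oo --> z))])).
Proof.
move=> zerPD alpha; split; first exact: stepsize_itv_nonempty.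
move=> gitv; have a0 : 0 < alpha by exact: stepsize_alpha_gt0.
split=> // lambda u v s lam liminf drs.
have gn : gamma != 0 by rewrite lt0r_neq0.
split=> [k uv|].
  have [Au] := drs k; rewrite -uv => Bu _; exact: drs_fixed_zer gn Au Bu.
right.
have [_ [zs0 Szs0] subS _] := minty.
pose c k := lambda k * (2 * alpha - lambda k).
have c0 k : 0 < c k.
  by have /andP[l0 l1] := lam k; rewrite mulr_gt0 // subr_gt0.
have fejer ss : shadow gamma Sstar ss -> forall k,
    dot (s k.+1 - ss) (s k.+1 - ss) <=
    dot (s k - ss) (s k - ss) - c k * dot (u k - v k) (u k - v k).
  move=> [zs Szs <-] k; have [Au Bv ->] := drs k; have /andP[l0 _] := lam k.
  have := fejer_step l0 (drs_pairing gamma_gt0 minty Szs Au Bv).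
  by rewrite -scalerN opprB.
pose ss0 := usubmx zs0 - gamma *: dsubmx zs0.
have Sss0 : shadow gamma Sstar ss0 by exists zs0.
have fejer_ni ss : shadow gamma Sstar ss ->
    nonincreasing_seq (fun k => dot (s k - ss) (s k - ss)).
  move=> Sss; apply/nonincreasing_seqP => k; apply: le_trans (fejer _ Sss k) _.
  by rewrite lerBlDr lerDl mulr_ge0 ?dot_ge0 // ltW.
have w0 : (fun k => u k - v k) @ \oo --> (0 : 'cV[R]_n).
  apply/cvg_dot_sub; under eq_fun do rewrite subr0.
  apply: descent_cvg0 (fejer _ Sss0) liminf => k; rewrite ?dot_ge0 //.
  exact: ltW (c0 k).
have [Ms sM] : exists M, forall k, dot (s k) (s k) <= M.
  exists (2 * dot (s 0%N - ss0) (s 0%N - ss0) + 2 * dot ss0 ss0) => k.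
  apply: le_trans (dot_le_sub (s k) ss0) _.
  by rewrite lerD2r ler_pM2l //; exact: (fejer_ni _ Sss0 0%N k).
have [Mu uM] : exists M, forall k, dot (u k) (u k) <= M.
  have [K K0 KA] := resolvent_linear_growth gamma_gt0 a0 minty Szs0.
  exists (2 * (K * dot (s 0%N - ss0) (s 0%N - ss0)) +
          2 * dot (usubmx zs0) (usubmx zs0)) => k.
  apply: le_trans (dot_le_sub (u k) (usubmx zs0)) _.
  rewrite lerD2r ler_pM2l //; have [Au _ _] := drs k.
  apply: le_trans (KA _ _ Au) _; rewrite ler_wpM2l //.
  exact: (fejer_ni _ Sss0 0%N k).
have lim_zer (G : set_system nat) (x l : 'cV[R]_n) :
    ProperFilter G -> \oo `<=` G -> u @ G --> x -> s @ G --> l ->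
    zerPD (col_mx x (gamma^-1 *: (x - l))).
  move=> PG sub ux sl; apply: drs_limit_zer gn oscA oscB drs _ ux sl.
  exact: cvg_trans (cvg_app _ sub) w0.
have shadow_zer (G : set_system nat) (l : 'cV[R]_n) :
    ProperFilter G -> \oo `<=` G -> s @ G --> l -> shadow gamma zerPD l.
  move=> PG sub sl; have [H [x [PH GH ux]]] := bounded_refine PG uM.
  have sH : s @ H --> l by exact: cvg_trans (cvg_app _ GH) sl.
  exists (col_mx x (gamma^-1 *: (x - l))).
    exact: lim_zer (subset_trans sub GH) ux sH.
  by rewrite col_mxKu col_mxKd scalerA divff // scale1r opprB addrC subrK.
split.
- split=> // k; have [Au Bv _] := drs k.
  move/(resolvent_scaleP _ _ _ gn): Au => Au.
  move/(resolvent_scaleP _ _ _ gn): Bv => Bv.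
  exists (gamma^-1 *: (s k - u k)) => //.
  exists (gamma^-1 *: (2 *: u k - s k - v k)) => //.
  rewrite -scalerDr; congr (_ *: _).
  by apply/matrixP => i j; rewrite !mxE; ring.
- move=> z /cluster_refine[G [PG sub zG]].
  have ux : u @ G --> usubmx z.
    have -> : u = fun k => usubmx (pd_seq gamma u s k).
      by apply/funext => k; rewrite col_mxKu.
    exact: cvg_usubmx.
  have yG : (fun k => gamma^-1 *: (u k - s k)) @ G --> dsubmx z.
    have -> : (fun k => gamma^-1 *: (u k - s k)) =
        fun k => dsubmx (pd_seq gamma u s k).
      by apply/funext => k; rewrite col_mxKd.
    exact: cvg_dsubmx.
  have sG : s @ G --> usubmx z - gamma *: dsubmx z.
    have -> : s = fun k => u k - gamma *: (gamma^-1 *: (u k - s k)).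
      by apply/funext => k; rewrite scalerA divff // scale1r opprB addrC subrK.
    by apply: cvgB => //; exact: cvgZr.
  have := lim_zer _ _ _ PG sub ux sG.
  by rewrite opprB addrC subrK scalerA mulVf // scale1r vsubmxK.
- split; last first.
    by move=> l /cluster_refine[G [PG sub sG]]; exact: shadow_zer PG sub sG.
  by exists (Num.sqrt Ms) => k; rewrite ler_wsqrtr.
- move=> kappa k0 kc ss Sss N; rewrite !sqr_enorm.
  under eq_bigr do rewrite sqr_enorm.
  apply: descent_bigmin (fejer _ Sss) k0 kc N => k; exact: dot_ge0.
move=> PiS.
have [G [l [PG sub sG]]] := bounded_refine eventually_filter sM.
have zl := shadow_zer G l PG sub sG.
have sl : s @ \oo --> l.
  apply: fejer_cvg PG sG (fejer_ni l _).
  by apply: shadow_subset_of_Pi_range zl => //; rewrite PiS.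
split; first by exists l.
move=> [f cf fA] _.
(* u is the image of s under a continuous map, so it converges in full. *)
have uf : u = f \o s.
  by apply/funext => k; have [+ _ _] := drs k; rewrite fA.
have uo : u @ \oo --> f l by rewrite uf; exact: cvg_comp sl (cf l).
exists (col_mx (f l) (gamma^-1 *: (f l - l))); first exact: lim_zer uo sl.
by apply: cvg_col_mx => //; apply: cvgZr; exact: cvgB.
Qed.
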